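(* Let $A(x,y)$ (respectively $A_{-irr}(x,y)$) be the formal power series in which the coefficient of $x^n y^k$ is the number of $321$-avoiding permutations (respectively, minus irreducible $321$-avoiding permutations) having exactly $n$ left-to-right maxima and exactly $k$ other elements, the empty permutation being included in both cases. Then $$A_{-irr}(x,y)=\frac{A(x,y)}{1+xy\,A(x,y)} .$$
   Context: A permutation $\pi=p_1p_2\cdots p_m$ of $\{1,\dots,m\}$ is written in one-line notation. It avoids $321$ if there are no indices $i<j<k$ with $p_i>p_j>p_k$. An entry $p_i$ is a left-to-right maximum if $p_i>p_j$ for all $j<i$. A permutation $\pi$ is minus irreducible if it contains no two consecutive entries of the form $i\,(i-1)$, i.e. there is no index $j$ with $p_{j+1}=p_j-1$. *)

(* Defs.v *)
From HB Require Import structures.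
From mathcomp Require Import all_boot all_order all_fingroup all_algebra.
From mathcomp Require Import boolp.

Set Implicit Arguments.
Unset Strict Implicit.
Unset Printing Implicit Defensive.

Import GRing.Theory.
Local Open Scope ring_scope.

Record fps (R : Type) := Fps { fps_coef :> nat -> R }.
Add Printing Coercion fps_coef.

Lemma fpsP (R : Type) (f g : fps R) : (forall n, f n = g n) -> f = g.
Proof. by case: f g => [f] [g] /= /funext ->. Qed.

HB.instance Definition _ (R : Type) := gen_eqMixin (fps R).
HB.instance Definition _ (R : Type) := gen_choiceMixin (fps R).

Section Ring.
Variable R : comNzRingType.
Implicit Types f g h : fps R.

Definition fps_zero : fps R := Fps (fun=> 0).
Definition fps_opp f : fps R := Fps (fun n => - f n).
Definition fps_add f g : fps R := Fps (fun n => f n + g n).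
Definition fpsC (c : R) : fps R := Fps (fun n => if n == 0%N then c else 0).
Definition fpsX : fps R := Fps (fun n => (n == 1%N)%:R).
Definition fps_mul f g : fps R :=
  Fps (fun n => \sum_(i < n.+1) f i * g (n - i)%N).

Fact fps_addA : associative fps_add.
Proof. by move=> f g h; apply: fpsP => n /=; rewrite addrA. Qed.
Fact fps_addC : commutative fps_add.
Proof. by move=> f g; apply: fpsP => n /=; rewrite addrC. Qed.
Fact fps_add0 : left_id fps_zero fps_add.
Proof. by move=> f; apply: fpsP => n /=; rewrite add0r. Qed.
Fact fps_addN : left_inverse fps_zero fps_opp fps_add.
Proof. by move=> f; apply: fpsP => n /=; rewrite addNr. Qed.

HB.instance Definition _ :=
  GRing.isZmodule.Build (fps R) fps_addA fps_addC fps_add0 fps_addN.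

Let trunc (N : nat) f : {poly R} := \poly_(i < N) f i.

Let trunc_mul (N : nat) f g (p q : {poly R}) :
    (forall i, (i < N)%N -> p`_i = f i) ->
    (forall i, (i < N)%N -> q`_i = g i) ->
  forall i, (i < N)%N -> (p * q)`_i = fps_mul f g i.
Proof.
move=> pf qg i iN; rewrite coefM /=; apply: eq_bigr => j _.
rewrite pf ?qg //; first exact: leq_ltn_trans (leq_subr _ _) iN.
by apply: leq_ltn_trans iN; rewrite -ltnS.
Qed.

Let truncE N f i : (i < N)%N -> (trunc N f)`_i = f i.
Proof. by move=> iN; rewrite coef_poly iN. Qed.

Fact fps_mulA : associative fps_mul.
Proof.
move=> f g h; apply: fpsP => n; pose t := trunc n.+1.
have tE := @truncE n.+1.
rewrite -(trunc_mul (tE f) (trunc_mul (tE g) (tE h)) (ltnSn n)).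
by rewrite mulrA (trunc_mul (trunc_mul (tE f) (tE g)) (tE h) (ltnSn n)).
Qed.

Fact fps_mulC : commutative fps_mul.
Proof.
move=> f g; apply: fpsP => n; have tE := @truncE n.+1.
rewrite -(trunc_mul (tE f) (tE g) (ltnSn n)) mulrC.
exact: (trunc_mul (tE g) (tE f) (ltnSn n)).
Qed.

Fact fps_mul1 : left_id (fpsC 1) fps_mul.
Proof.
move=> f; apply: fpsP => n /=; rewrite big_ord_recl /= mul1r subn0.
by rewrite big1 ?addr0 // => i _; rewrite mul0r.
Qed.

Fact fps_mulDl : left_distributive fps_mul fps_add.
Proof.
move=> f g h; apply: fpsP => n /=; rewrite -big_split.
by apply: eq_bigr => i _; rewrite mulrDl.
Qed.

Fact fps_oner_neq0 : fpsC 1 != 0.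
Proof.
apply/eqP => /(congr1 (fun f : fps R => f 0%N)) /= /eqP.
by rewrite oner_eq0.
Qed.

HB.instance Definition _ := GRing.Zmodule_isComNzRing.Build (fps R)
  fps_mulA fps_mulC fps_mul1 fps_mulDl fps_oner_neq0.

Lemma fps_coefD f g n : (f + g) n = f n + g n. Proof. by []. Qed.

Lemma fps_coefM f g n : (f * g) n = \sum_(i < n.+1) f i * g (n - i)%N.
Proof. by []. Qed.

Lemma fps_coef1 n : (1 : fps R) n = (n == 0%N)%:R.
Proof. by case: n. Qed.

(* The invertible series are, literally, those having a multiplicative
   inverse; they are characterised by fps_unitE below. *)
Definition fps_unit : {pred fps R} := fun f => `[< exists g, g * f = 1 >].

Definition fps_inv f : fps R :=
  if pselect (exists g, g * f = 1) is left ex then projT1 (cid ex) else f.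

Fact fps_mulVr : {in fps_unit, left_inverse 1 fps_inv *%R}.
Proof.
move=> f /asboolP ex; rewrite /fps_inv; case: pselect => [ex'|//].
exact: projT2 (cid ex').
Qed.

Fact fps_unitPl f g : g * f = 1 -> fps_unit f.
Proof. by move=> gf1; apply/asboolP; exists g. Qed.

Fact fps_inv_out : {in [predC fps_unit], fps_inv =1 id}.
Proof. by move=> f /asboolP nex; rewrite /fps_inv; case: pselect. Qed.

HB.instance Definition _ := GRing.ComNzRing_hasMulInverse.Build (fps R)
  fps_mulVr fps_unitPl fps_inv_out.

End Ring.

Arguments fpsX {R}.

Section Unit.
Variables (R : comUnitRingType) (f : fps R).

Let invs := fix invs n : seq R := if n is m.+1 then
  rcons (invs m)
    (((m == 0%N)%:R - \sum_(i < m) (invs m)`_i * f (m - i)%N) / f 0%N)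
  else [::].

Let size_invs n : size (invs n) = n.
Proof. by elim: n => //= n IH; rewrite size_rcons IH. Qed.

Let nth_invs n i : (i < n)%N -> (invs n)`_i = (invs i.+1)`_i.
Proof.
elim: n => // n IH; rewrite ltnS leq_eqVlt => /predU1P[-> //|lin].
by rewrite -IH //= nth_rcons size_invs lin.
Qed.

Lemma fps_unitE : (f \is a GRing.unit) = (f 0%N \is a GRing.unit).
Proof.
apply/idP/idP => [/mulVr/(congr1 (fun g : fps R => g 0%N))|Uf0].
  rewrite fps_coefM big_ord1 /= subnn => f1; apply/unitrPr.
  by exists (f^-1 0%N); rewrite mulrC.
apply/unitrPr; exists (Fps (fun n => (invs n.+1)`_n)).
rewrite mulrC; apply: fpsP => n; rewrite fps_coefM fps_coef1 big_ord_recr /=.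
rewrite subnn nth_rcons size_invs ltnn eqxx divrK //.
under eq_bigr => i _ do rewrite -[rcons _ _]/(invs i.+1) -(nth_invs (ltn_ord i)).
by rewrite addrC subrK.
Qed.

End Unit.

(* Z[[x,y]] is encoded as Z[[y]][[x]]: the coefficient of x^n y^k in F is
   F n k. *)
Notation fps2 := (fps (fps int)).

Definition varx : fps2 := fpsX.
Definition vary : fps2 := fpsC fpsX.

Definition gen_series (a : nat -> nat -> nat) : fps2 :=
  Fps (fun n => Fps (fun k => (a n k)%:Z)).

Lemma unit_denominator (F : fps2) : 1 + varx * vary * F \is a GRing.unit.
Proof.
rewrite fps_unitE fps_coefD !fps_coefM big_ord1 fps_coefM big_ord1 /=.
by rewrite !mul0r addr0 unitr1.
Qed.

(* A permutation s : 'S_m is the word s 0, ..., s (m-1) on {0, ..., m-1};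
   the notions below are unaffected by shifting positions and values by 1. *)
Section Permutations.
Variable m : nat.
Implicit Type s : 'S_m.

Definition avoids321 s : bool :=
  ~~ [exists i : 'I_m, exists j : 'I_m, exists k : 'I_m,
        [&& i < j, j < k, s j < s i & s k < s j]%N].

Definition is_lrmax s (i : 'I_m) : bool :=
  [forall j : 'I_m, (j < i)%N ==> (s j < s i)%N].

Definition minus_irreducible s : bool :=
  ~~ [exists i : 'I_m, exists j : 'I_m,
        (j == i.+1 :> nat) && (s i == (s j).+1 :> nat)].

End Permutations.

(* A permutation with n left-to-right maxima and k other entries has
   length n + k. *)
Definition num_av321 (n k : nat) : nat :=
  #|[set s : 'S_(n + k) | [&& avoids321 s,
       #|[set i | is_lrmax s i]| == n & #|[set i | ~~ is_lrmax s i]| == k]]|.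

Definition num_av321_irr (n k : nat) : nat :=
  #|[set s : 'S_(n + k) | [&& avoids321 s, minus_irreducible s,
       #|[set i | is_lrmax s i]| == n & #|[set i | ~~ is_lrmax s i]| == k]]|.

Definition A_series : fps2 := gen_series num_av321.
Definition A_irr_series : fps2 := gen_series num_av321_irr.

(* Main.v *)
Require Import Defs.
From mathcomp Require Import all_boot all_algebra.
From mathcomp Require Import all_fingroup boolp zify.
Local Open Scope ring_scope.
Import GRing.Theory.

Set Implicit Arguments.
Unset Strict Implicit.
Unset Printing Implicit Defensive.

(** In a 321-avoiding permutation, two consecutive entries [i (i-1)] cut the
    word: an earlier entry above [i] would complete a 321 with both of them, and
    so would a later entry below [i-1].  Hence every earlier entry is smaller and
    every later entry is larger, that is, the permutation is a direct sum
    [u (+) 21 (+) v] with the pair as its middle summand.  Cutting at the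
    leftmost such pair makes [u] minus irreducible, and conversely every
    irreducible 321-avoiding [u] and every 321-avoiding [v] give a reducible
    321-avoiding permutation whose leftmost pair sits just after [u].  Since
    left-to-right maxima add up along direct sums and [21] has one maximum and one
    other entry, [A = A_irr + x y A_irr A], which is the claim because the
    denominator is a unit.

    The argument is carried out on words, that is, sequences of numbers that
    permute [0, ..., m-1]: there direct sums are concatenations, without casts
    between symmetric groups.  The cut is [reducible_decomposition], its
    uniqueness [insert21_inj], the resulting count [size_reducible_words]; the
    lemma [card_perm_words] carries counts over from permutations to words. *)

(** * Statistics on words *)

Section Words.
Local Open Scope nat_scope.
Implicit Types u v w : seq nat.

Definition perm_word w : bool := perm_eq w (iota 0 (size w)).

Definition lrmax_at w j : bool := all (fun x => x < nth 0 w j) (take j w).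

Definition num_lrmax w : nat := count (lrmax_at w) (iota 0 (size w)).

(** A word contains 321 as soon as some entry has a larger one before it and a
    smaller one after it, so the pattern can be tested at its middle entry. *)
Definition middle321_at w j : bool :=
  has (fun x => nth 0 w j < x) (take j w)
  && has (fun x => x < nth 0 w j) (drop j.+1 w).

Definition avoids321w w : bool := ~~ has (middle321_at w) (iota 0 (size w)).

Definition irreduciblew w : bool := sorted (fun x y => x != y.+1) w.

Lemma perm_word_mem w x : perm_word w -> (x \in w) = (x < size w).
Proof. by move/perm_mem->; rewrite mem_iota. Qed.

Lemma num_lrmax_le_size w : num_lrmax w <= size w.
Proof. by rewrite -[leqRHS](size_iota 0) count_size. Qed.

(** * Direct sums *)

Definition dsum u v : seq nat := u ++ map (addn (size u)) v.

Lemma size_dsum u v : size (dsum u v) = size u + size v.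
Proof. by rewrite size_cat size_map. Qed.

Lemma iota_dsum m n : iota 0 (m + n) = iota 0 m ++ map (addn m) (iota 0 n).
Proof. by rewrite iotaD add0n -[X in iota X n]addn0 iotaDl. Qed.

Lemma perm_word_dsum u v : perm_word u -> perm_word v -> perm_word (dsum u v).
Proof.
move=> pu pv; rewrite /perm_word size_dsum iota_dsum.
by apply: perm_cat => //; apply: perm_map.
Qed.

Lemma nth_dsum_left u v j : j < size u -> nth 0 (dsum u v) j = nth 0 u j.
Proof. by move=> ju; rewrite nth_cat ju. Qed.

Lemma nth_dsum_right u v j :
  j < size v -> nth 0 (dsum u v) (size u + j) = size u + nth 0 v j.
Proof. by move=> jv; rewrite nth_cat ltnNge leq_addr addKn (nth_map 0). Qed.

Lemma take_dsum_left u v j : j < size u -> take j (dsum u v) = take j u.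
Proof. by move=> ju; rewrite take_cat ju. Qed.

Lemma take_dsum_right u v j : take (size u + j) (dsum u v) = dsum u (take j v).
Proof. by rewrite take_cat ltnNge leq_addr addKn -map_take. Qed.

(** The remaining [u] is shorter than [u] by [j+1], whence the shift of [v]. *)
Lemma drop_dsum_left u v j : j < size u ->
  drop j.+1 (dsum u v) = dsum (drop j.+1 u) (map (addn j.+1) v).
Proof.
move=> ju; rewrite /dsum -map_comp drop_cat size_drop; case: ltnP => [_|uj].
  by congr (_ ++ _); apply: eq_map => x /=; lia.
rewrite [drop j.+1 u]drop_oversize // (_ : j.+1 - size u = 0) ?drop0; last by lia.
by apply: eq_map => x /=; lia.
Qed.

Lemma drop_dsum_right u v j :
  drop (size u + j).+1 (dsum u v) = map (addn (size u)) (drop j.+1 v).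
Proof. by rewrite -addnS drop_cat ltnNge leq_addr addKn map_drop. Qed.

(** All of [u] lies below the shifted [v], so no entry of [u] prevents an entry of
    [v] from being a left-to-right maximum. *)
Lemma num_lrmax_dsum u v :
  perm_word u -> num_lrmax (dsum u v) = num_lrmax u + num_lrmax v.
Proof.
move=> pu; rewrite /num_lrmax size_dsum iota_dsum count_cat; congr (_ + _).
  apply: eq_in_count => j; rewrite mem_iota /= => ju.
  by rewrite /lrmax_at nth_dsum_left // take_dsum_left.
rewrite count_map; apply: eq_in_count => j; rewrite mem_iota /= => jv.
rewrite /lrmax_at nth_dsum_right // take_dsum_right all_cat all_map.
rewrite (_ : all _ u = true) /=; last first.
  by apply/allP => x; rewrite perm_word_mem // => /= /ltn_addr->.
by apply: eq_all => x /=; rewrite ltn_add2l.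
Qed.

(** No inversion crosses a direct sum, and a 321 is connected by its
    inversions: it lies in one of the summands. *)
Lemma avoids321w_dsum u v :
  perm_word u -> avoids321w (dsum u v) = avoids321w u && avoids321w v.
Proof.
move=> pu; rewrite /avoids321w size_dsum iota_dsum has_cat negb_or.
congr (~~ _ && ~~ _).
  apply: eq_in_has => j; rewrite mem_iota /= => ju.
  rewrite /middle321_at nth_dsum_left // take_dsum_left // drop_dsum_left //.
  rewrite has_cat -map_comp has_map [X in _ && (_ || X)](_ : _ = false) ?orbF //.
  have := mem_nth 0 ju; rewrite perm_word_mem // => lt_u.
  apply/hasP => -[x _] /=; rewrite size_drop addnA subnK //.
  by move=> /ltn_trans/(_ lt_u); rewrite ltnNge leq_addr.
rewrite has_map; apply: eq_in_has => j; rewrite mem_iota /= => jv.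
rewrite /middle321_at nth_dsum_right // take_dsum_right // drop_dsum_right //.
rewrite has_cat !has_map [X in (X || _) && _](_ : _ = false) /=; last first.
  by apply/hasP => -[x]; rewrite perm_word_mem //; lia.
by congr (_ && _); apply: eq_has => x /=; rewrite ltn_add2l.
Qed.

(** Sorting [u] and [v] separately sorts [u ++ v], so it yields the two
    halves of [0, 1, 2, ...]. *)
Lemma perm_word_split u v : perm_word (u ++ v) -> allrel ltn u v ->
  perm_word u /\ exists2 v', perm_word v' & u ++ v = dsum u v'.
Proof.
rewrite /perm_word size_cat iotaD add0n => puv ltuv.
have e : sort leq u ++ sort leq v = iota 0 (size u) ++ iota (size u) (size v).
  apply: (sorted_eq leq_trans anti_leq).
  - rewrite (sorted_pairwise leq_trans) pairwise_cat -!(sorted_pairwise leq_trans).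
    rewrite !sort_sorted ?andbT; try exact: leq_total.
    apply/allrelP => x y; rewrite !mem_sort => xu yv.
    exact: ltnW (allrelP ltuv _ _ xu yv).
  - by rewrite -[X in iota X (size v)]add0n -iotaD iota_sorted.
  - by rewrite -(permPr puv) perm_cat ?perm_sort.
have /andP[/eqP eu /eqP ev] :
    (sort leq u == iota 0 (size u)) && (sort leq v == iota (size u) (size v)).
  by rewrite -eqseq_cat ?e // size_sort size_iota.
split; first by rewrite -eu perm_sym perm_sort.
have pv : perm_eq v (iota (size u) (size v)) by rewrite -ev perm_sym perm_sort.
have vK : map (addn (size u)) (map (subn^~ (size u)) v) = v.
  rewrite -map_comp map_id_in // => x; rewrite (perm_mem pv) mem_iota /=; lia.
exists (map (subn^~ (size u)) v); last by rewrite /dsum vK.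
apply: (perm_map_inj (@addnI (size u))).
by rewrite vK size_map -iotaDl addn0.
Qed.

(** * Cutting at an adjacent pair [i (i-1)] *)

Definition insert21 u v : seq nat := dsum u (dsum [:: 1; 0] v).

Lemma perm_word_insert21 u v :
  perm_word u -> perm_word v -> perm_word (insert21 u v).
Proof. by move=> pu pv; do 2!apply: perm_word_dsum => //. Qed.

Lemma size_insert21 u v : size (insert21 u v) = size u + (size v).+2.
Proof. by rewrite !size_dsum. Qed.

Lemma num_lrmax_insert21 u v :
  perm_word u -> num_lrmax (insert21 u v) = num_lrmax u + (num_lrmax v).+1.
Proof. by move=> pu; rewrite !num_lrmax_dsum. Qed.

Lemma avoids321w_insert21 u v :
  perm_word u -> avoids321w (insert21 u v) = avoids321w u && avoids321w v.
Proof. by move=> pu; rewrite !avoids321w_dsum. Qed.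

Lemma nth_insert21_size u v : nth 0 (insert21 u v) (size u) = (size u).+1.
Proof. by have := @nth_dsum_right u (dsum [:: 1; 0] v) 0 isT; rewrite addn0 addn1. Qed.

Lemma nth_insert21_sizeS u v : nth 0 (insert21 u v) (size u).+1 = size u.
Proof. by have := @nth_dsum_right u (dsum [:: 1; 0] v) 1 isT; rewrite addn0 addn1. Qed.

Lemma irreduciblew_insert21 u v : ~~ irreduciblew (insert21 u v).
Proof.
apply/negP => /(sortedP 0)/(_ (size u)).
by rewrite nth_insert21_size nth_insert21_sizeS eqxx size_insert21; lia.
Qed.

(** If [u] were shorter than [u'], the pair following [u] would lie inside [u'],
    or overlap its end; the first contradicts irreducibility, and in the second
    case the two entries would be in increasing order. *)
Lemma irreduciblew_insert21_size u v u' v' : irreduciblew u' ->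
  insert21 u v = insert21 u' v' -> size u' <= size u.
Proof.
move=> iu' e; rewrite leqNgt; apply/negP => lt_uu'.
have := nth_insert21_sizeS u v; have := nth_insert21_size u v.
rewrite e nth_dsum_left // => e1.
have [lt_Suu'|] := ltnP (size u).+1 (size u').
  rewrite nth_dsum_left // => e2.
  by have := sortedP 0 iu' _ lt_Suu'; rewrite e1 e2 eqxx.
move=> le_u'; have {le_u'} -> : (size u).+1 = size u' by lia.
by rewrite nth_insert21_size; lia.
Qed.

(** The length of the irreducible part is the position of the leftmost pair
    [i (i-1)], so it can be read off the word. *)
Lemma insert21_inj u v u' v' : irreduciblew u -> irreduciblew u' ->
  insert21 u v = insert21 u' v' -> u = u' /\ v = v'.
Proof.
move=> iu iu' e.
have su : size u = size u'.
  apply/eqP; rewrite eqn_leq (irreduciblew_insert21_size iu (esym e)).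
  exact: irreduciblew_insert21_size iu' e.
move/eqP: e; rewrite eqseq_cat // => /andP[/eqP<- /eqP].
by move/(inj_map (@addnI _)) => /= [] /(inj_map (@addnI _)).
Qed.

(** The cut at the leftmost pair [i (i-1)]: avoidance of 321, with [i] as the
    middle entry, bounds the entries before the pair, and with [i-1] as the middle
    entry, those after it. *)
Lemma reducible_decomposition w :
    perm_word w -> avoids321w w -> ~~ irreduciblew w ->
  exists u v, [/\ perm_word u, irreduciblew u, perm_word v & w = insert21 u v].
Proof.
move=> pw aw rw.
have uw : uniq w by rewrite (perm_uniq pw) iota_uniq.
have exi : exists i, (i.+1 < size w) && (nth 0 w i == (nth 0 w i.+1).+1).
  apply: contrapT => nex; case/negP: rw; apply/(sortedP 0) => i lti.
  by apply/negP => ei; apply: nex; exists i; rewrite lti.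
case: (ex_minnP exi) => p /andP[ltp /eqP ep] minp {exi}.
set a := nth 0 w p.+1 in ep; set u := take p w; set r := drop p.+2 w.
have su : size u = p by rewrite size_takel //; lia.
have ew : w = u ++ [:: a.+1, a & r].
  by rewrite -[LHS](cat_take_drop p) (drop_nth 0) 1?(drop_nth 0) ?ep //; lia.
have iu : irreduciblew u.
  apply/(sortedP 0) => i; rewrite su => lti; rewrite !nth_take //; last by lia.
  by apply/negP => ei; have := minp i; rewrite ei andbT; lia.
have no_mid j : j < size w -> ~~ middle321_at w j.
  by move=> ltj; apply: (hasPn aw); rewrite mem_iota.
(* Otherwise x, w_p, a form a 321. *)
have ltu x : x \in u -> x < a.
  move=> xu; rewrite ltnNge; apply/negP => ax.
  have /negP[] := no_mid p (ltnW ltp); rewrite /middle321_at ep; apply/andP; split.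
    apply/hasP; exists x => //; move: uw; rewrite ew cat_uniq => /and3P[_ + _].
    rewrite /= !negb_or => /and3P[n1 n2 _].
    have x1 : x != a.+1 by apply: contraNneq n1 => <-.
    have x2 : x != a by apply: contraNneq n2 => <-.
    lia.
  by apply/hasP; exists a => //; rewrite (drop_nth 0) // mem_head.
(* Otherwise w_p, a, y form a 321. *)
have gtr y : y \in r -> a.+1 < y.
  move=> yr; rewrite ltnNge; apply/negP => ya.
  have /negP[] := no_mid p.+1 ltp; rewrite /middle321_at -/a; apply/andP; split.
    apply/hasP; exists a.+1 => //.
    by rewrite (take_nth 0) ?ep ?mem_rcons ?mem_head // ltnW.
  apply/hasP; exists y => //; move: uw; rewrite ew cat_uniq => /and3P[_ _].
  rewrite /= inE negb_or => /and3P[/andP[_ n1] n2 _].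
  have y1 : y != a.+1 by apply: contraNneq n1 => <-.
  have y2 : y != a by apply: contraNneq n2 => <-.
  lia.
have [pu [v1 pv1 ew1]] : perm_word u /\
    exists2 v, perm_word v & u ++ [:: a.+1, a & r] = dsum u v.
  apply: perm_word_split; first by rewrite -ew.
  apply/allrelP => x y /ltu ltxa; rewrite !inE => /or3P[/eqP->|/eqP->|/gtr]; lia.
have e1 : [:: a.+1, a & r] = map (addn (size u)) v1.
  by apply/eqP; move/eqP: ew1; rewrite eqseq_cat // eqxx.
case: v1 e1 pv1 {ew1} => [//|b [//|c t]] [eb ec et] pv1.
(* Split off the pair; being a permutation word, it can only be 1 0. *)
have [p21 [v pv ev]] : perm_word [:: b; c] /\
    exists2 v, perm_word v & [:: b; c] ++ t = dsum [:: b; c] v.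
  apply: perm_word_split => //; apply/allrelP => x y; rewrite !inE.
  move=> /orP[]/eqP-> yt;
    have := gtr (size u + y); rewrite et map_f // => /(_ isT); lia.
exists u, v; split => //.
have [eb1 ec0] : b = 1 /\ c = 0.
  have := perm_word_mem b p21; have := perm_word_mem c p21; rewrite !inE !eqxx orbT /=.
  lia.
by rewrite ew eb ec et /insert21 -eb1 -{1}ec0 -ev.
Qed.

(** * Counting reducible words *)

Definition av_words n k : seq (seq nat) :=
  [seq w <- permutations (iota 0 (n + k)) | avoids321w w && (num_lrmax w == n)].

Definition av_irr_words n k : seq (seq nat) :=
  [seq w <- av_words n k | irreduciblew w].

Lemma mem_av_words n k w : (w \in av_words n k) =
  [&& perm_word w, size w == n + k, avoids321w w & num_lrmax w == n].
Proof.
rewrite mem_filter mem_permutations andbC [RHS]andbA; congr andb.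
apply/idP/andP => [pw|[+ /eqP<-]//].
have sw : size w = n + k by rewrite (perm_size pw) size_iota.
by rewrite /perm_word sw.
Qed.

Lemma mem_av_irr_words n k w :
  (w \in av_irr_words n k) = irreduciblew w && (w \in av_words n k).
Proof. exact: mem_filter. Qed.

Lemma uniq_av_words n k : uniq (av_words n k).
Proof. by rewrite filter_uniq ?permutations_uniq. Qed.


(** The pair (i, j) counts the maxima and the other entries of the irreducible
    part; the inserted 21 takes one of each, which leaves [n - i - 1] and
    [k - j - 1] for the other part. *)
Lemma size_reducible_words n k :
  size [seq w <- av_words n k | ~~ irreduciblew w] =
  \sum_(i < n) \sum_(j < k)
    size (av_irr_words i j) * size (av_words (n - i.+1) (k - j.+1)).
Proof.
pose P (ij : 'I_n * 'I_k) : seq (seq nat * seq nat) :=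
  [seq (u, v) | u <- av_irr_words ij.1 ij.2,
                v <- av_words (n - ij.1.+1) (k - ij.2.+1)].
pose L := [seq insert21 uv.1 uv.2 | ij <- enum {: 'I_n * 'I_k}, uv <- P ij].
have memP ij u v : (u, v) \in P ij -> [/\ irreduciblew u,
    u \in av_words ij.1 ij.2 & v \in av_words (n - ij.1.+1) (k - ij.2.+1)].
  by case/allpairsP => -[u' v'] [/= + pv [-> ->]]; rewrite mem_av_irr_words => /andP[].
have uniqL : uniq L.
  apply: allpairs_uniq_dep; first exact: enum_uniq.
    move=> ij _; apply: allpairs_uniq; rewrite ?filter_uniq ?permutations_uniq //.
    by move=> [u v] [u' v'].
  move=> x y /allpairsPdep[ij [[u v] [_ /memP[iu + _] ->]]].
  rewrite mem_av_words => /and4P[_ /eqP su _ /eqP lu].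
  move=> /allpairsPdep[ij' [[u' v'] [_ /memP[iu' + _] ->]]] /=.
  rewrite mem_av_words => /and4P[_ /eqP su' _ /eqP lu'] e.
  have [eu ev] := insert21_inj iu iu' e; subst u' v'.
  suff -> : ij = ij' by [].
  case: ij ij' su lu su' lu' => [i j] [i' j'] /= su lu su' lu'.
  by congr pair; apply: val_inj => /=; lia.
have sizeL : size L = \sum_(i < n) \sum_(j < k)
    size (av_irr_words i j) * size (av_words (n - i.+1) (k - j.+1)).
  rewrite size_allpairs_dep sumnE big_map big_enum /= pair_bigA /=.
  by apply: eq_bigr => ij _; rewrite size_allpairs.
rewrite -sizeL; apply: perm_size; apply: uniq_perm => //.
  by rewrite filter_uniq ?uniq_av_words.
move=> w; rewrite mem_filter mem_av_words; apply/idP/allpairsPdep; last first.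
  case=> [[i j] [[u v] [_ /memP /= [iu + +] ->]]].
  rewrite !mem_av_words => /and4P[pu su au lu] /and4P[pv sv av lv].
  rewrite irreduciblew_insert21 perm_word_insert21 // avoids321w_insert21 // au av.
  rewrite size_insert21 num_lrmax_insert21 // (eqP su) (eqP sv) (eqP lu) (eqP lv).
  by have := ltn_ord i; have := ltn_ord j; lia.
case/andP=> rw /and4P[pw /eqP sw aw /eqP lw].
have [u [v [pu iu pv ew]]] := reducible_decomposition pw aw rw.
rewrite {}ew {rw pw} in sw aw lw *.
move: sw aw lw; rewrite avoids321w_insert21 // size_insert21 num_lrmax_insert21 //.
move=> sw /andP[au av] lw.
have lu := num_lrmax_le_size u; have lv := num_lrmax_le_size v.
have ltn : num_lrmax u < n by lia.
have ltk : size u - num_lrmax u < k by lia.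
exists (Ordinal ltn, Ordinal ltk), (u, v); split => //; first by rewrite mem_enum.
apply: allpairs_f; rewrite ?mem_av_irr_words ?iu /= mem_av_words ?pu ?pv ?au ?av /=; lia.
Qed.

End Words.

(** * From permutations to words *)

Section PermWord.
Local Open Scope nat_scope.
Variable m : nat.
Implicit Type s : 'S_m.

Definition word s : seq nat := [seq (s i : nat) | i <- enum 'I_m].

Lemma size_word s : size (word s) = m.
Proof. by rewrite size_map size_enum_ord. Qed.

Lemma nth_word s (i : 'I_m) : nth 0 (word s) i = s i.
Proof. by rewrite (nth_map i) ?size_enum_ord // nth_ord_enum. Qed.

Lemma word_inj : injective word.
Proof.
move=> s t e; apply/permP => i; apply: val_inj.
by rewrite -[LHS]nth_word e nth_word.
Qed.

Lemma wordP w : reflect (exists s, w = word s) (perm_eq w (iota 0 m)).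
Proof.
have wE s : word s = [tuple tnth (iota_tuple m 0) (s i) | i < m].
  by apply: eq_map => i /=; rewrite (tnth_nth 0) nth_iota.
by apply: (iffP (@tuple_permP _ _ w (iota_tuple m 0))) => -[s ->]; exists s;
  rewrite wE.
Qed.

Lemma lrmax_at_word s (i : 'I_m) : lrmax_at (word s) i = is_lrmax s i.
Proof.
have si : size (take i (word s)) = i by rewrite size_takel // size_word ltnW.
rewrite /lrmax_at nth_word; apply/(all_nthP 0)/forallP; rewrite si => H j.
  by apply/implyP => ji; rewrite -nth_word -(nth_take 0 ji) H.
move=> ji; have jm := ltn_trans ji (ltn_ord i).
by rewrite nth_take // (nth_word s (Ordinal jm)) (implyP (H (Ordinal jm))).
Qed.

Lemma num_lrmax_word s : num_lrmax (word s) = #|[set i | is_lrmax s i]|.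
Proof.
rewrite /num_lrmax size_word -val_enum_ord count_map -sum1_count big_enum_cond.
by rewrite cardsE -sum1_card; apply: eq_bigl => i /=; rewrite lrmax_at_word.
Qed.

Lemma avoids321w_word s : avoids321w (word s) = avoids321 s.
Proof.
congr (~~ _); apply/hasP/existsP; rewrite size_word.
  case=> j; rewrite mem_iota /= => jm /andP[].
  rewrite (nth_word s (Ordinal jm)) => /(has_nthP 0)[i ij sij] /(has_nthP 0)[k kj sjk].
  have sj : size (take j (word s)) = j by rewrite size_takel // size_word ltnW.
  rewrite sj in ij.
  have im : i < m := ltn_trans ij jm.
  rewrite nth_take // (nth_word s (Ordinal im)) in sij.
  rewrite size_drop size_word in kj.
  have km : j.+1 + k < m by rewrite -ltn_subRL.
  rewrite nth_drop (nth_word s (Ordinal km)) in sjk.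
  exists (Ordinal im); apply/existsP; exists (Ordinal jm).
  by apply/existsP; exists (Ordinal km); rewrite ij sij sjk /= leq_addr.
case=> i /existsP[j /existsP[k /and4P[ij jk sij sjk]]].
exists (nat_of_ord j); first by rewrite mem_iota /= ltn_ord.
rewrite /middle321_at nth_word; apply/andP; split; apply/(has_nthP 0).
  by exists i; rewrite ?nth_take ?nth_word // size_takel // size_word ltnW.
exists (k - j.+1); rewrite ?size_drop ?size_word ?nth_drop ?subnKC ?nth_word //.
by have := ltn_ord k; lia.
Qed.

Lemma irreduciblew_word s : irreduciblew (word s) = minus_irreducible s.
Proof.
apply/(sortedP 0)/existsPn; rewrite size_word => H i.
  apply/existsPn => j; apply/negP => /andP[/eqP ij sij].
  by have := H i; rewrite -ij ltn_ord !nth_word sij => /(_ isT).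
move=> im; have := H (Ordinal (ltnW im)) => /existsPn/(_ (Ordinal im)).
by rewrite eqxx -!nth_word.
Qed.

Lemma card_perm_words (P : pred 'S_m) (Q : pred (seq nat)) :
  (forall s, Q (word s) = P s) ->
  #|[set s | P s]| = size [seq w <- permutations (iota 0 m) | Q w].
Proof.
move=> QP; rewrite cardE -(size_map word); apply: perm_size; apply: uniq_perm.
- by rewrite (map_inj_uniq word_inj) enum_uniq.
- by rewrite filter_uniq ?permutations_uniq.
move=> w; rewrite mem_filter mem_permutations; apply/mapP/andP.
  case=> s; rewrite mem_enum inE => Ps ->.
  by rewrite QP; split => //; apply/wordP; exists s.
by case=> Qw /wordP[s ew]; move: Qw; rewrite ew QP => Ps; exists s; rewrite // mem_enum inE.
Qed.

End PermWord.

(** * The recurrence and the functional equation *)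

Section Counting.
Local Open Scope nat_scope.

(** The length is fixed to [n + k], so the number of maxima determines the number
    of other entries. *)
Lemma lrmax_counts n k (s : 'S_(n + k)) :
  (#|[set i | is_lrmax s i]| == n) && (#|[set i | ~~ is_lrmax s i]| == k)
  = (num_lrmax (word s) == n).
Proof.
rewrite num_lrmax_word.
have := cardsC [set i | is_lrmax s i]; rewrite card_ord.
have -> : ~: [set i | is_lrmax s i] = [set i | ~~ is_lrmax s i].
  by apply/setP => i; rewrite !inE.
lia.
Qed.

Lemma num_av321E n k : num_av321 n k = size (av_words n k).
Proof.
apply: card_perm_words => s.
by rewrite lrmax_counts avoids321w_word.
Qed.

Lemma num_av321_irrE n k : num_av321_irr n k = size (av_irr_words n k).
Proof.
rewrite /av_irr_words -filter_predI; apply: card_perm_words => s /=.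
by rewrite lrmax_counts avoids321w_word irreduciblew_word andbCA.
Qed.

Lemma num_av321_rec n k : num_av321 n k = num_av321_irr n k +
  \sum_(i < n) \sum_(j < k)
    num_av321_irr i j * num_av321 (n - i.+1) (k - j.+1).
Proof.
under eq_bigr do under eq_bigr do rewrite num_av321E num_av321_irrE.
rewrite -size_reducible_words num_av321E num_av321_irrE.
by rewrite -(count_predC irreduciblew) -!size_filter.
Qed.

End Counting.

Lemma fpsX_mul0 (R : comNzRingType) (F : fps R) : (fpsX * F) 0%N = 0.
Proof. by rewrite fps_coefM big_ord1 /= mul0r. Qed.

Lemma fpsX_mulS (R : comNzRingType) (F : fps R) n : (fpsX * F) n.+1 = F n.
Proof.
rewrite fps_coefM !big_ord_recl /= mul0r add0r mul1r subn1 big1 ?addr0 // => i _.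
by rewrite mul0r.
Qed.

Lemma fpsC_mulE (R : comNzRingType) (c : R) (F : fps R) n :
  (fpsC c * F) n = c * F n.
Proof.
by rewrite fps_coefM big_ord_recl /= subn0 big1 ?addr0 // => i _; rewrite mul0r.
Qed.

Lemma fps_coef_sum (R : comNzRingType) I (r : seq I) (F : I -> fps R) n :
  (\sum_(i <- r) F i) n = \sum_(i <- r) F i n.
Proof. exact: (big_morph (fun f : fps R => f n)). Qed.

Lemma A_series_decomposition :
  A_series = A_irr_series + varx * vary * (A_irr_series * A_series).
Proof.
apply: fpsP => n; apply: fpsP => k.
rewrite !fps_coefD -mulrA [LHS]/= num_av321_rec PoszD; congr (_ + _).
case: n => [|n]; first by rewrite fpsX_mul0 big_ord0.
rewrite fpsX_mulS fpsC_mulE; case: k => [|k].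
  by rewrite fpsX_mul0 big1 // => i _; rewrite big_ord0.
rewrite fpsX_mulS.
rewrite fps_coefM fps_coef_sum (big_morph Posz PoszD erefl).
apply: eq_bigr => i _; rewrite (big_morph Posz PoszD erefl) fps_coefM.
by apply: eq_bigr => j _; rewrite PoszM !subSS.
Qed.

Theorem mainTheorem2 :
  A_irr_series = A_series / (1 + varx * vary * A_series).
Proof.
rewrite {1}A_series_decomposition; apply/esym/(canLR (mulrK (unit_denominator _))).
by rewrite mulrDr mulr1 mulrCA.
Qed.
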